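(* Let $(n_1,n_2)$ and $\underline m=(m_1,m_2)$ be compositions of $n$ with two parts, let $G=GL(n,\mathbb{R})$, let $P_{\underline m}$ be the standard maximal parabolic subgroup of $G$ associated with $\underline m$, and let $B'$ be the standard Borel subgroup of $GL(n_1,\mathbb{R})\times GL(n_2,\mathbb{R})\subset G$. Let $(e_1,\dots,e_{n_1})$ and $(f_1,\dots,f_{n_2})$ be the canonical bases of $\mathbb{R}^{n_1}$ and $\mathbb{R}^{n_2}$. Then the closed $B'$-orbits on $\mathcal D_{\underline m}\simeq G/P_{\underline m}$ coincide with the $B'$-fixed points. More explicitly, they are given by $$\begin{bmatrix}0&\cdots&0&e_1&\cdots&e_{m_1-r}\\ f_1&\cdots&f_r&0&\cdots&0\end{bmatrix}$$ for $r\in\{\max(0,m_1-n_1),\dots,\min(m_1,n_2)\}$.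
   Context: A composition of $n$ is a finite sequence of positive integers with sum $n$. $P_{\underline m}$ is the group of invertible block upper triangular matrices with diagonal blocks of sizes $m_1,m_2$. $GL(n_1,\mathbb{R})\times GL(n_2,\mathbb{R})$ is embedded block diagonally in $GL(n,\mathbb{R})$ and $B'$ is its subgroup of upper triangular matrices. $\mathcal D_{\underline m}$ is the Grassmannian of $m_1$-dimensional subspaces of $\mathbb{R}^n=\mathbb{R}^{n_1}\oplus\mathbb{R}^{n_2}$, identified (with its topology) with $G/P_{\underline m}$ and with the quotient of the set of $n\times m_1$ real matrices of rank $m_1$ by the right action of $GL(m_1,\mathbb{R})$. A matrix in square brackets denotes its class, i.e. its column span; the upper row consists of vectors in $\mathbb{R}^{n_1}$ and the lower row of vectors in $\mathbb{R}^{n_2}$. *)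

(* Defs.v *)
From HB Require Import structures.
From mathcomp Require Import all_boot all_order all_algebra perm.
From mathcomp Require Import all_classical all_reals all_analysis.

Set Implicit Arguments.
Unset Strict Implicit.
Unset Printing Implicit Defensive.

Import Order.TTheory GRing.Theory Num.Theory.
Import numFieldNormedType.Exports.

Local Open Scope classical_set_scope.
Local Open Scope ring_scope.
Local Open Scope quotient_scope.

Record GL (R : realType) (n : nat) := MkGL {
  GLmx : 'M[R]_n;
  GLmx_unit : GLmx \in unitmx }.

Record frame (R : realType) (n m : nat) := MkFrame {
  frame_mx : 'M[R]_(n, m);
  frame_rankE : \rank frame_mx == m }.

Record grassmann (R : realType) (n m : nat) := MkGrassmann {
  grass_vs : {vspace 'cV[R]_n};
  grass_dimE : \dim grass_vs == m }.

HB.instance Definition _ R n := [isSub for @GLmx R n].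
HB.instance Definition _ R n := [Choice of GL R n by <:].
HB.instance Definition _ R n m := [isSub for @frame_mx R n m].
HB.instance Definition _ R n m := [Choice of frame R n m by <:].
HB.instance Definition _ R n m := [isSub for @grass_vs R n m].

(* [GL R n] and [frame R n m] carry the subspace topology of the usual
   topology on matrices. *)
HB.instance Definition _ R n :=
  Topological.copy (GL R n) (initial_topology (@GLmx R n)).
HB.instance Definition _ R n m :=
  Topological.copy (frame R n m) (initial_topology (@frame_mx R n m)).

Definition colspan (R : realType) (n m : nat) (A : 'M[R]_(n, m)) :
  {vspace 'cV[R]_n} := <<[tuple col j A | j < m]>>%VS.

Section Colspan.
Context {R : realType} {n : nat}.

Lemma sum_colE m (A : 'M[R]_(n, m)) (k : 'I_m -> R) :
  \sum_(j < m) k j *: [tuple col j A | j < m]`_j = A *m \col_j k j.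
Proof.
apply/colP => i; rewrite summxE mxE; apply: eq_bigr => j _.
by rewrite -(tnth_nth 0) tnth_mktuple !mxE mulrC.
Qed.

Lemma colspanP m (A : 'M[R]_(n, m)) (v : 'cV[R]_n) :
  reflect (exists k : 'cV[R]_m, v = A *m k) (v \in colspan A).
Proof.
apply: (iffP idP) => [vA|[k ->]].
  by rewrite (coord_span vA) sum_colE; eexists.
have -> : k = \col_j k j 0 by apply/colP => j; rewrite mxE.
rewrite -sum_colE; apply: memv_suml => j _; apply: memvZ.
by apply: memv_span; rewrite -(tnth_nth 0) mem_tnth.
Qed.

Lemma free_col m (A : 'M[R]_(n, m)) :
  free [tuple col j A | j < m] = (\rank A == m).
Proof.
apply/freeP/eqP => [fA|rA k].
  rewrite -mxrank_tr; apply/eqP; apply: inj_row_free => v vA0.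
  have {vA0} : \sum_(j < m) v 0 j *: [tuple col j A | j < m]`_j = 0.
    rewrite sum_colE; apply: trmx_inj; rewrite trmx0 -[RHS]vA0 trmx_mul.
    by congr (_ *m _); apply/rowP => j; rewrite !mxE.
  by move=> /fA v0; apply/rowP => j; rewrite mxE v0.
rewrite sum_colE => Ak0 i.
have fr : row_free A^T by rewrite /row_free mxrank_tr rA.
have : (\col_j k j)^T *m A^T = 0 *m A^T by rewrite -trmx_mul Ak0 mul0mx trmx0.
by move=> /(row_free_inj fr) /rowP/(_ i); rewrite !mxE.
Qed.

Lemma colspan_dim m (A : 'M[R]_(n, m)) : \rank A = m -> \dim (colspan A) = m.
Proof.
by move=> /eqP; rewrite -free_col /free size_tuple => /eqP.
Qed.

Lemma mem_col m (A : 'M[R]_(n, m)) (j : 'I_m) : col j A \in colspan A.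
Proof. by apply: memv_span; apply/mapP; exists j; rewrite ?mem_enum. Qed.

(* Two rank-[m] matrices have the same class iff they differ by the right
   action of [GL(m)]. *)
Lemma colspan_eqP m (A B : 'M[R]_(n, m)) : \rank A = m -> \rank B = m ->
  colspan A = colspan B <-> exists2 g : 'M[R]_m, g \in unitmx & B = A *m g.
Proof.
move=> rA rB; split=> [eAB|[g gu ->]].
  have k_ j : {k : 'cV[R]_m | col j B = A *m k}.
    by apply: cid; apply/colspanP; rewrite eAB mem_col.
  have BE : B = A *m \matrix_(i, j) (sval (k_ j)) i 0.
    apply/matrixP => i j; have /colP/(_ i) := svalP (k_ j).
    by rewrite !mxE => ->; apply: eq_bigr => l _; rewrite mxE.
  move: (\matrix_(i, j) _) BE => g BE; exists g => //.
  by rewrite -row_free_unit /row_free eqn_leq rank_leq_row -{1}rB BE mxrankM_maxr.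
apply/vspaceP => v; apply/colspanP/colspanP => -[k ->].
  by exists (invmx g *m k); rewrite -mulmxA mulKVmx.
by exists (g *m k); rewrite mulmxA.
Qed.

End Colspan.

Section Grassmann.
Context {R : realType} {n m : nat}.

Lemma frame_rank (A : frame R n m) : \rank (frame_mx A) = m.
Proof. exact/eqP/frame_rankE. Qed.

Lemma grass_dim (V : grassmann R n m) : \dim (grass_vs V) = m.
Proof. exact/eqP/grass_dimE. Qed.

Definition grass_class (A : frame R n m) : grassmann R n m :=
  MkGrassmann (introT eqP (colspan_dim (frame_rank A))).

Lemma vs_frame_subproof (V : grassmann R n m) :
  exists A : frame R n m, colspan (frame_mx A) = grass_vs V.
Proof.
have sb : size (vbasis (grass_vs V)) == m by rewrite size_tuple grass_dim.
pose t : m.-tuple 'cV[R]_n := Tuple sb.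
pose A : 'M[R]_(n, m) := \matrix_(i, j) tnth t j i 0.
have At : [tuple col j A | j < m] = t.
  by apply: eq_from_tnth => j; rewrite tnth_mktuple; apply/colP => i; rewrite !mxE.
have rA : \rank A = m.
  by apply/eqP; rewrite -free_col At; apply: basis_free (vbasisP _).
exists (MkFrame (introT eqP rA)).
by rewrite /= /colspan At (span_basis (vbasisP _)).
Qed.

Definition grass_frame (V : grassmann R n m) : frame R n m :=
  sval (cid (vs_frame_subproof V)).

Lemma grass_frameK : cancel grass_frame grass_class.
Proof. by move=> V; apply: val_inj; exact: svalP (cid (vs_frame_subproof V)). Qed.

HB.instance Definition _ :=
  isQuotient.Build (frame R n m) (grassmann R n m) grass_frameK.

End Grassmann.

(* The quotient topology along [grass_class]. *)
HB.instance Definition _ R n m := Topological.copy (grassmann R n m)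
  (quotient_topology (grassmann R n m)).

Lemma grass_openE (R : realType) (n m : nat) (U : set (grassmann R n m)) :
  open U = open (grass_class @^-1` U).
Proof. by rewrite /open/= /quotient_open unlock. Qed.

Section Action.
Context {R : realType} {n m : nat}.

Lemma grass_act_subproof (g : GL R n) (V : grassmann R n m) :
  \dim (linfun (mulmx (GLmx g)) @: grass_vs V)%VS == m.
Proof.
rewrite limg_dim_eq ?grass_dim//; apply/eqP; rewrite -subv0.
apply/subvP => v /memv_capP[_]; rewrite memv_ker lfunE /= => /eqP gv0.
by rewrite memv0 -[v](mulKmx (GLmx_unit g)) gv0 mulmx0.
Qed.

Definition grass_act (g : GL R n) (V : grassmann R n m) : grassmann R n m :=
  MkGrassmann (grass_act_subproof g V).

Definition is_orbit (H : set (GL R n)) (Z : set (grassmann R n m)) : Prop :=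
  exists V, Z = [set grass_act h V | h in H].

Definition fixed_points (H : set (GL R n)) : set (grassmann R n m) :=
  [set V | forall h, H h -> grass_act h V = V].

End Action.

Lemma grass_act_class (R : realType) (n m : nat) (g : GL R n)
    (A : 'M[R]_(n, m)) :
  (linfun (mulmx (GLmx g)) @: colspan A)%VS = colspan (GLmx g *m A).
Proof.
apply/vspaceP => v; apply/memv_imgP/colspanP => [[u /colspanP[k ->] ->]|[k ->]].
  by exists k; rewrite lfunE /= mulmxA.
exists (A *m k); first by apply/colspanP; exists k.
by rewrite lfunE /= mulmxA.
Qed.

Section GLgroup.
Context {R : realType} {n : nat}.

Lemma GL_mul_subproof (g h : GL R n) : GLmx g *m GLmx h \in unitmx.
Proof. by rewrite unitmx_mul !GLmx_unit. Qed.

Definition GL_mul (g h : GL R n) : GL R n := MkGL (GL_mul_subproof g h).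

Lemma GL_inv_subproof (g : GL R n) : invmx (GLmx g) \in unitmx.
Proof. by rewrite unitmx_inv GLmx_unit. Qed.

Definition GL_inv (g : GL R n) : GL R n := MkGL (GL_inv_subproof g).

End GLgroup.

Definition parabolic (R : realType) (m1 m2 : nat) : set (GL R (m1 + m2)) :=
  [set g | exists (a : 'M[R]_m1) (b : 'M[R]_(m1, m2)) (d : 'M[R]_m2),
     [/\ a \in unitmx, d \in unitmx & GLmx g = block_mx a b 0 d]].

(* [flag R m1 m2] is [G / P_m] with the quotient topology; [flag_grass] below
   is the homeomorphism identifying it with the Grassmannian. *)
Section Flag.
Context {R : realType} {m1 m2 : nat}.
Implicit Types g h : GL R (m1 + m2).

Definition coset_rel : rel (GL R (m1 + m2)) :=
  fun g h => `[< parabolic (GL_mul (GL_inv g) h) >].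

Lemma first_cols_rank g : \rank (lsubmx (GLmx g)) == m1.
Proof.
have -> : lsubmx (GLmx g) = GLmx g *m col_mx 1%:M 0.
  by rewrite -{2}[GLmx g]hsubmxK mul_row_col mulmx1 mulmx0 addr0.
rewrite -mxrank_tr trmx_mul mxrankMfree; last first.
  by rewrite row_free_unit unitmx_tr GLmx_unit.
by rewrite mxrank_tr -addsmxE addsmx0 mxrank1.
Qed.

Definition first_cols g : frame R (m1 + m2) m1 := MkFrame (first_cols_rank g).

Lemma coset_relE g h :
  coset_rel g h = (grass_class (first_cols g) == grass_class (first_cols h)).
Proof.
have E : (grass_class (first_cols g) = grass_class (first_cols h)) <->
    colspan (lsubmx (GLmx g)) = colspan (lsubmx (GLmx h)).
  by split=> [/(congr1 (@grass_vs _ _ _))//|e]; apply: val_inj.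
apply/asboolP/eqP; rewrite E.
  move=> [a [b [d [au du gh]]]]; apply/colspan_eqP; try exact/eqP/first_cols_rank.
  exists a => //.
  have -> : GLmx h = GLmx g *m block_mx a b 0 d by rewrite -gh /= mulKVmx ?GLmx_unit.
  rewrite -mulmx_lsub block_mxEh row_mxKl -[GLmx g in LHS]hsubmxK.
  by rewrite mul_row_col mulmx0 addr0.
move=> /colspan_eqP[||a au ha]; try exact/eqP/first_cols_rank.
pose p := GL_mul (GL_inv g) h.
have lp : lsubmx (GLmx p) = col_mx a 0.
  rewrite /= -mulmx_lsub ha mulmxA mulmx_lsub mulVmx ?GLmx_unit//.
  by rewrite scalar_mx_block block_mxEh row_mxKl mul_col_mx mul1mx mul0mx.
have pE : GLmx p =
    block_mx a (usubmx (rsubmx (GLmx p))) 0 (dsubmx (rsubmx (GLmx p))).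
  by rewrite block_mxEh vsubmxK -lp hsubmxK.
move: (usubmx _) (dsubmx _) pE => b d pE.
exists a, b, d; split=> //.
by have := GLmx_unit p; rewrite pE !unitmxE det_ublock unitrM => /andP[].
Qed.

Lemma coset_rel_refl : reflexive coset_rel.
Proof. by move=> g; rewrite coset_relE. Qed.

Lemma coset_rel_sym : symmetric coset_rel.
Proof. by move=> g h; rewrite !coset_relE eq_sym. Qed.

Lemma coset_rel_trans : transitive coset_rel.
Proof. by move=> g f h; rewrite !coset_relE => /eqP-> /eqP->. Qed.

Canonical coset_equiv : equiv_rel (GL R (m1 + m2)) :=
  EquivRel coset_rel coset_rel_refl coset_rel_sym coset_rel_trans.

End Flag.

Definition flag (R : realType) (m1 m2 : nat) : topologicalType :=
  quotient_topology {eq_quot @coset_equiv R m1 m2}.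

Definition coset (R : realType) (m1 m2 : nat) (g : GL R (m1 + m2)) :
  flag R m1 m2 := \pi_(quotient_topology {eq_quot @coset_equiv R m1 m2}) g.

Section FlagGrass.
Context {R : realType} {m1 m2 : nat}.
Implicit Types g h : GL R (m1 + m2).

Lemma coset_surj (x : flag R m1 m2) : exists g, x = coset g.
Proof. by exists (repr x); rewrite /coset reprK. Qed.

Lemma coset_eqP g h : coset g = coset h <-> parabolic (GL_mul (GL_inv g) h).
Proof.
split=> [/(@eqmodP _ coset_equiv)/asboolP//|gh].
by apply/(@eqmodP _ coset_equiv)/asboolP.
Qed.

Definition flag_grass (x : flag R m1 m2) : grassmann R (m1 + m2) m1 :=
  grass_class (first_cols (sval (cid (coset_surj x)))).

Lemma flag_grass_coset g : flag_grass (coset g) = grass_class (first_cols g).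
Proof.
rewrite /flag_grass; case: (cid _) => h /= /coset_eqP/asboolP.
by rewrite -/(coset_rel g h) coset_relE => /eqP.
Qed.

Lemma flag_grass_inj : injective flag_grass.
Proof.
move=> x y; have [g ->] := coset_surj x; have [h ->] := coset_surj y.
rewrite !flag_grass_coset => /eqP; rewrite -coset_relE => /asboolP.
by rewrite -coset_eqP.
Qed.

Lemma grass_class_inj n m (A B : frame R n m) :
  grass_class A = grass_class B <->
  exists2 a : 'M[R]_m, a \in unitmx & frame_mx B = frame_mx A *m a.
Proof.
rewrite -colspan_eqP ?frame_rank//.
by split=> [/(congr1 (@grass_vs _ _ _))//|e]; apply: val_inj.
Qed.

(* Any frame can be completed to an invertible matrix. *)
Lemma first_cols_surj (A : frame R (m1 + m2) m1) :
  exists g : GL R (m1 + m2), first_cols g = A.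
Proof.
have rA : row_free (frame_mx A)^T by rewrite /row_free mxrank_tr frame_rank.
have rC : \rank ((frame_mx A)^T^C)%MS = m2.
  by rewrite mxrank_compl mxrank_tr frame_rank addKn.
pose C := castmx (rC, erefl (m1 + m2)%N) (row_base ((frame_mx A)^T^C)%MS).
have gu : row_mx (frame_mx A) C^T \in unitmx.
  rewrite -unitmx_tr tr_row_mx trmxK -row_full_unit -sub1mx -addsmxE.
  have := addsmx_compl_full (frame_mx A)^T; rewrite -sub1mx => /submx_trans; apply.
  by apply: addsmxS => //; rewrite eqmx_cast eq_row_base.
by exists (MkGL gu); apply: val_inj; rewrite /= row_mxKl.
Qed.

Lemma flag_grass_surj (V : grassmann R (m1 + m2) m1) :
  exists x, flag_grass x = V.
Proof.
have [g gV] := first_cols_surj (grass_frame V).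
by exists (coset g); rewrite flag_grass_coset gV grass_frameK.
Qed.

Lemma flag_grass_bij : bijective flag_grass.
Proof.
exists (fun V => sval (cid (flag_grass_surj V))) => x.
  by apply: flag_grass_inj; case: (cid _).
by case: (cid _).
Qed.

Lemma flag_grass_act g h :
  flag_grass (coset (GL_mul g h)) = grass_act g (flag_grass (coset h)).
Proof.
rewrite !flag_grass_coset; apply: val_inj => /=.
by rewrite grass_act_class mulmx_lsub.
Qed.

End FlagGrass.

Section FlagHomeo.
Context {R : realType}.

Lemma cts_mxP (T : topologicalType) n m (f : T -> 'M[R]_(n, m)) (x : T) :
  (forall i j, f y i j @[y --> x] --> f x i j) -> f y @[y --> x] --> f x.
Proof.
move=> fij A [P Pn PA].
have : \forall y \near x, forall i, forall j, P i j (f y i j).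
  by apply: filter_forall => i; apply: filter_forall => j; exact/fij/Pn.
by apply: filterS => y Py; exact: PA.
Qed.

Lemma det_continuous n : continuous (fun A : 'M[R]_n => \det A).
Proof.
rewrite /determinant.
apply: (@continuous_big R _ +%R 0 xpredT (@add_continuous R)) => s _ A.
apply: (@cvgM R _ (nbhs A) _ (fun=> (-1) ^+ s)
  (fun B : 'M[R]_n => \prod_i B i (s i))); first exact: cvg_cst.
move: A; apply: (@continuous_big R _ *%R 1 xpredT (@mul_continuous R)) => i _.
exact: coord_continuous.
Qed.

Lemma open_unitmx n : open [set A : 'M[R]_n | A \in unitmx].
Proof.
have -> : [set A : 'M[R]_n | A \in unitmx] =
    (fun A => \det A) @^-1` [set x : R | x != 0].
  by apply/seteqP; split=> A /=; rewrite unitmxE unitfE.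
move: (@det_continuous n) => /continuousP; apply.
exact: open_neq.
Qed.

Context {m1 m2 : nat}.
Local Notation flag_grass := (@flag_grass R m1 m2).

Lemma first_cols_continuous : continuous (@first_cols R m1 m2).
Proof.
apply/continuousP => _ [W oW <-].
have -> : first_cols @^-1` (@frame_mx R (m1 + m2) m1 @^-1` W) =
    @GLmx R (m1 + m2) @^-1` ((fun g => lsubmx g) @^-1` W) by [].
eexists; last by [].
have : continuous (fun g : 'M[R]_(m1 + m2) => lsubmx g).
  move=> g; apply: cts_mxP => i j; rewrite mxE.
  under eq_fun do rewrite mxE.
  exact: coord_continuous.
by move/continuousP; exact.
Qed.

Lemma flag_grass_continuous : continuous flag_grass.
Proof.
apply/quotient_continuous.
apply/continuousP => U oU.
have -> : (flag_grass \o \pi_(flag R m1 m2)) @^-1` U =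
    first_cols @^-1` (grass_class @^-1` U).
  by apply/seteqP; split=> g /=; rewrite flag_grass_coset.
move/continuousP: first_cols_continuous; apply.
by rewrite -grass_openE.
Qed.

Lemma flag_grass_open (U : set (flag R m1 m2)) :
  open U -> open (flag_grass @` U).
Proof.
move=> oU; rewrite grass_openE openE => A [x Ux xA].
have [g gA] := first_cols_surj A.
have gx : x = coset g by apply: flag_grass_inj; rewrite flag_grass_coset gA.
have [W oW WU] : open (@coset R m1 m2 @^-1` U) by exact: oU.
pose e (B : 'M[R]_(m1 + m2, m1)) : 'M[R]_(m1 + m2) :=
  row_mx B (rsubmx (GLmx g)).
have e_cont : continuous e.
  move=> B; apply: cts_mxP => i j; rewrite mxE; under eq_fun do rewrite mxE.
  case: (fintype.split j) => k; first exact: coord_continuous.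
  by move=> S /nbhs_singleton Sk; apply: (@filterS _ (nbhs B) _ setT) => [C _|]; [|exact: filterT].
pose O := e @^-1` (W `&` [set h | h \in unitmx]).
have oO : open O.
  move/continuousP: e_cont; apply; apply: openI => //; exact: open_unitmx.
have eA : e (frame_mx A) = GLmx g by rewrite /e -gA hsubmxK.
rewrite /interior nbhsE; exists (@frame_mx R _ _ @^-1` O).
  split; first by exists O.
  split=> /=; rewrite eA ?GLmx_unit//.
  by have : (@coset R m1 m2 @^-1` U) g by [rewrite /= -gx]; rewrite -WU.
move=> B /= [WB uB]; exists (coset (MkGL uB)).
  by have : (@GLmx R (m1 + m2) @^-1` W) (MkGL uB) by []; rewrite WU.
by rewrite flag_grass_coset; congr grass_class; apply: val_inj; rewrite /= row_mxKl.
Qed.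

Lemma flag_grass_homeo :
  [/\ bijective flag_grass, continuous flag_grass &
      forall U, open U -> open (flag_grass @` U)].
Proof.
split; [exact: flag_grass_bij|exact: flag_grass_continuous|].
exact: flag_grass_open.
Qed.

End FlagHomeo.

(* [GL(n1) x GL(n2)] and its standard Borel subgroup [B'] in [GL(n1 + n2)]. *)
Definition levi (R : realType) (n1 n2 : nat) : set (GL R (n1 + n2)) :=
  [set g | exists (a : 'M[R]_n1) (d : 'M[R]_n2),
     [/\ a \in unitmx, d \in unitmx & GLmx g = block_mx a 0 0 d]].

Definition upper_triangular (R : realType) (n : nat) : set (GL R n) :=
  [set g | forall i j : 'I_n, (j < i)%N -> GLmx g i j = 0].

Definition levi_borel (R : realType) (n1 n2 : nat) : set (GL R (n1 + n2)) :=
  @levi R n1 n2 `&` @upper_triangular R (n1 + n2).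

Arguments levi_borel : clear implicits.

(* With 0-based indices, column [j] of [point_mx R n1 n2 m1 r] is [(0, f_j)]
   for [j < r] and [(e_(j - r), 0)] for [r <= j]. *)
Definition point_mx (R : realType) (n1 n2 m1 r : nat) : 'M[R]_(n1 + n2, m1) :=
  col_mx (\matrix_(i < n1, j < m1) ((r <= j)%N && (i == j - r :> nat)%N)%:R)
         (\matrix_(i < n2, j < m1) ((j < r)%N && (i == j :> nat))%:R).

(* Main.v *)
(** [B'] is the unit group of the incidence algebra of the poset [{1..n}] ordered
    by "[i <= j] in the same block", so a subspace [W] is [B']-fixed iff
    [E_ij W] is contained in [W] for all [i <= j] in this poset, and the fixed
    subspaces are the spans of unions of initial segments of the two bases.  Let
    the orbit of [W] be closed, and suppose [e_i] is not in [W] although some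
    vector of [W] has [v_j <> 0].  The limit of [(1 + s E_ij) W] as [s] tends to
    infinity contains [e_i] and all vectors of [W] with vanishing [j]-th
    coordinate.  It lies in the orbit of [W], so it meets the invariant subspace
    [F_i], the span of [e_k] for [k <= i], in the same dimension as [W]; this is
    a contradiction as soon as the [j]-th coordinate vanishes on [W :&: F_i].
    That is clear for [i <> j], and the case [i = j] follows from the stability
    under [E_ki] for [k < i]. *)
Require Import Defs.
From mathcomp Require Import all_boot all_order all_algebra zify.
From mathcomp Require Import all_classical all_reals all_analysis.

Local Open Scope classical_set_scope.

Set Implicit Arguments.
Unset Strict Implicit.
Unset Printing Implicit Defensive.

(** * The action on subspaces, and closed sets of the Grassmannian *)

Section GrassmannAction.
Import Order.TTheory GRing.Theory Num.Theory.
Import numFieldNormedType.Exports.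
Local Open Scope ring_scope.
Context {R : realType} {n m : nat}.
Implicit Types (V W : grassmann R n m) (h : GL R n).

Lemma grass_act_mulP h V (v : 'cV[R]_n) :
  reflect (exists2 u, u \in grass_vs V & v = GLmx h *m u)
          (v \in grass_vs (grass_act h V)).
Proof.
by apply: (iffP memv_imgP) => -[u uV ->]; exists u; rewrite ?lfunE.
Qed.

Lemma eq_grass_sub V W :
  (grass_vs V <= grass_vs W)%VS -> V = W.
Proof.
by move=> VW; apply/val_inj/eqP; rewrite /= eqEdim VW !grass_dim leqnn.
Qed.

Lemma grass_act_fixP h V :
  grass_act h V = V <->
  forall v, v \in grass_vs V -> GLmx h *m v \in grass_vs V.
Proof.
split=> [hV v vV|hV]; first by rewrite -hV; apply/grass_act_mulP; exists v.
by apply: eq_grass_sub; apply/subvP => _ /grass_act_mulP[v vV ->]; exact: hV.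
Qed.

Lemma lker_GLmx h : lker (linfun (mulmx (GLmx h) : 'cV[R]_n -> _)) == 0%VS.
Proof.
apply/lker0P => u v; rewrite !lfunE /= => /(congr1 (mulmx (invmx (GLmx h)))).
by rewrite !mulKmx ?GLmx_unit.
Qed.

(** As [h] is injective, stability of [F] forces h F = F, whence h V :&: F = h (V :&: F). *)
Lemma grass_act_dim_cap h V (F : {vspace 'cV[R]_n}) :
  (forall v, v \in F -> GLmx h *m v \in F) ->
  \dim (grass_vs (grass_act h V) :&: F) = \dim (grass_vs V :&: F).
Proof.
move=> hF; have kh := lker_GLmx h.
have dimh (U : {vspace 'cV[R]_n}) :
      \dim (linfun (mulmx (GLmx h)) @: U)%VS = \dim U.
  by apply: limg_dim_eq; rewrite (eqP kh) capv0.
have eF : (linfun (mulmx (GLmx h)) @: F)%VS = F.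
  apply/eqP; rewrite eqEdim dimh leqnn andbT.
  by apply/subvP => _ /memv_imgP[v vF ->]; rewrite lfunE; exact: hF.
by rewrite -[in LHS]eF -lker0_img_cap// dimh.
Qed.

Lemma mulmxl_continuous p (C : 'M[R]_(p, n)) :
  continuous (fun A : 'M[R]_(n, m) => C *m A).
Proof.
move=> A; apply: cts_mxP => i j; rewrite mxE; under eq_fun do rewrite mxE.
move: A; apply: (@continuous_big R _ +%R 0 xpredT (@add_continuous R)) => k _ A.
apply: (@cvgM R _ (nbhs A) _ (fun=> C i k) (fun B : 'M[R]_(n, m) => B k j)).
  exact: cvg_cst.
exact: coord_continuous.
Qed.

Lemma frame_mx_continuous : continuous (@frame_mx R n m).
Proof. exact: initial_continuous. Qed.

Lemma grass_closedE (Z : set (grassmann R n m)) :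
  closed Z = closed (grass_class @^-1` Z).
Proof. by rewrite -[Z in LHS]setCK -[Z in RHS]setCK preimage_setC !closedC grass_openE. Qed.

(** Frames carry the topology induced from matrices, so a closed set of frames is the trace of a
    closed set [D] of matrices. A limit can thus be taken among matrices before its rank is
    known. *)
Lemma grass_closed_mx (Z : set (grassmann R n m)) : closed Z ->
  exists2 D : set 'M[R]_(n, m), closed D &
    forall A : frame R n m, Z (grass_class A) <-> D (frame_mx A).
Proof.
rewrite grass_closedE -openC => -[U oU UE]; exists (~` U); first exact: open_closedC.
move=> A; rewrite -[Z _]/((grass_class @^-1` Z) A) -[grass_class @^-1` Z]setCK -UE.
by split.
Qed.

(** The frames of [V] are the frames B with C B = 0, where the rows of [C] span the linear forms
    vanishing on [V]; this is a closed condition. *)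
Lemma grass_closed1 V : closed [set V].
Proof.
rewrite grass_closedE.
have [A AV] : exists A, grass_class A = V by exists (grass_frame V); exact: grass_frameK.
pose C := (cokermx (frame_mx A)^T)^T.
have -> : grass_class @^-1` [set V] =
    (fun B : frame R n m => C *m frame_mx B) @^-1` [set 0].
  apply/seteqP; split=> B /=; rewrite -AV.
    move=> /esym/grass_class_inj[a _ ->]; apply: trmx_inj.
    by rewrite !trmx_mul trmxK -mulmxA mulmx_coker mulmx0 trmx0.
  move=> /(congr1 trmx)/eqP; rewrite trmx_mul trmxK trmx0 -submxE => /submxP[a Ba].
  apply: eq_grass_sub; apply/subvP => _ /colspanP[k ->]; apply/colspanP.
  exists (a^T *m k); rewrite mulmxA; congr (_ *m _); apply: trmx_inj.
  by rewrite trmx_mul trmxK.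
apply: preimage_closed => [B _|]; last first.
  exact: (accessible_closed_set1 (hausdorff_accessible (@norm_hausdorff _ _))).
apply: (@continuous_comp _ _ _ (@frame_mx R n m) (mulmx C)).
  exact: frame_mx_continuous.
exact: mulmxl_continuous.
Qed.

End GrassmannAction.

(** * Incidence groups, their fixed points and limits under elementary matrices *)

Section IncidenceGroup.
Import Order.TTheory GRing.Theory Num.Theory.
Import numFieldNormedType.Exports.
Local Open Scope ring_scope.
Context {R : realType} {n : nat} (po : rel 'I_n).

Definition incidence_group : set (GL R n) :=
  [set g | forall i j, ~~ po i j -> GLmx g i j = 0].

Lemma mul_delta_col (i j : 'I_n) (v : 'cV[R]_n) :
  delta_mx i j *m v = v j 0 *: delta_mx i 0.
Proof.
apply/colP => k; rewrite !mxE (bigD1 j)//= big1 ?addr0 => [|l /negbTE lj].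
  by rewrite !mxE !eqxx !andbT mulrC.
by rewrite !mxE lj andbF mul0r.
Qed.

(** Since E_ij squares to [d] E_ij, the inverse is 1 - t E_ij. The sign of [s] keeps the denominator
    1 + s d nonzero when i = j. *)
Lemma elementary_unit (s : R) (i j : 'I_n) : 0 <= s ->
  1%:M + s *: delta_mx i j \in unitmx.
Proof.
move=> s0; pose d : R := (i == j)%:R; pose t := s / (1 + s * d).
have u0 : 1 + s * d != 0 by rewrite gt_eqF// ltr_pwDl// mulr_ge0// ler0n.
have dd : (delta_mx i j : 'M[R]_n) *m delta_mx i j = d *: delta_mx i j.
  by rewrite mul_delta_mx_cond eq_sym scaler_nat.
have /mulmx1_unit[] : (1%:M + s *: delta_mx i j) *m (1%:M - t *: delta_mx i j) =
    1%:M :> 'M[R]_n; last by [].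
rewrite mulmxBr mulmx1 mulmxDl mul1mx -!scalemxAl -!scalemxAr dd !scalerA.
rewrite -scalerDl -addrA -scalerBl.
have -> : s - (t + s * t * d) = 0.
  by rewrite mulrAC [s * d * t]mulrC -{1}[t]mulr1 -mulrDr divfK// subrr.
by rewrite scale0r addr0.
Qed.

Definition elementary (s : R) (s0 : 0 <= s) (i j : 'I_n) : GL R n :=
  MkGL (elementary_unit i j s0).

Hypothesis po_refl : reflexive po.

Lemma elementary_incidence (s : R) (s0 : 0 <= s) (i j : 'I_n) : po i j ->
  incidence_group (elementary s0 i j).
Proof.
move=> ij k l kl; rewrite /= !mxE.
have [kl0|_] := eqVneq k l; first by rewrite kl0 po_refl in kl.
case: eqVneq => [ki|_]; last by rewrite mulr0 addr0.
by case: eqVneq => [lj|_]; [rewrite ki lj ij in kl|rewrite mulr0 addr0].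
Qed.

Lemma incidence_group1 : incidence_group !=set0.
Proof.
exists (MkGL (unitmx1 R n)) => i j; rewrite /= mxE.
by case: eqVneq => // ->; rewrite po_refl.
Qed.

(** The element 1 + E_ij adds v_j e_i to v, so stability yields e_i when v_j <> 0. Conversely, h v
    is the sum of the h_ij v_j e_i, where only pairs with [po i j] contribute. *)
Lemma incidence_fixedP m (V : grassmann R n m) :
  fixed_points incidence_group V <->
  forall i j v, po i j -> v \in grass_vs V -> v j 0 != 0 ->
    delta_mx i 0 \in grass_vs V.
Proof.
split=> [Vf i j v ij vV vj0|VP h hH].
  have /grass_act_fixP/(_ v vV) := Vf _ (elementary_incidence ler01 ij).
  rewrite /= scale1r mulmxDl mul1mx mul_delta_col rpredDl//.
  by rewrite rpredZeq (negbTE vj0).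
apply/grass_act_fixP => v vV.
have -> : GLmx h *m v = \sum_i \sum_j (GLmx h i j * v j 0) *: delta_mx i 0.
  apply/colP => k; rewrite mxE summxE [RHS](bigD1 k)//= [X in _ + X]big1 ?addr0.
    by rewrite summxE; apply: eq_bigr => j _; rewrite !mxE !eqxx mulr1.
  move=> i /negbTE ik; rewrite summxE big1// => j _.
  by rewrite !mxE eq_sym ik mulr0.
apply: memv_suml => i _; apply: memv_suml => j _.
have [->|vj0] := eqVneq (v j 0) 0; first by rewrite mulr0 scale0r mem0v.
have [ij|/hH ->] := boolP (po i j); last by rewrite mul0r scale0r mem0v.
by apply: memvZ; exact: VP vV vj0.
Qed.

(* The limit of [(1 + e^-1 E_ij) V] as [e] tends to [0+]: for a frame [A] of
   [V], [w = row j A] and [w *m c = 1], the invertible [g = 1 + (e - 1) c w]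
   satisfies [w g = e w], so that the frame [(1 + e^-1 E_ij) A g] is
   [A g + E_ij A], which is polynomial in [e]. *)
Lemma elementary_limit m (Z : set (grassmann R n m)) (V : grassmann R n m)
    (i j : 'I_n) (v : 'cV[R]_n) :
  closed Z -> (forall s (s0 : 0 <= s), Z (grass_act (elementary s0 i j) V)) ->
  v \in grass_vs V -> v j 0 != 0 -> delta_mx i 0 \notin grass_vs V ->
  exists2 W : grassmann R n m, Z W &
    delta_mx i 0 \in grass_vs W /\
    forall u, u \in grass_vs V -> u j 0 = 0 -> u \in grass_vs W.
Proof.
move=> cZ ZV vV vj0 iV.
have [D cD ZD] := grass_closed_mx cZ.
have [A0 AV] : exists A, grass_class A = V.
  by exists (grass_frame V); exact: grass_frameK.
pose A := frame_mx A0; have VA : grass_vs V = colspan A by rewrite -AV.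
pose w := row j A.
have wE k : w *m k = ((A *m k) j 0)%:M.
  by apply/matrixP => a b; rewrite !ord1 -row_mul !mxE mulr1n.
(* [c] is the coordinate vector of [v] in the frame [A], divided by v_j. *)
have [c wc] : exists c : 'cV[R]_m, w *m c = 1%:M.
  move: vV; rewrite VA => /colspanP[k vE]; exists ((v j 0)^-1 *: k).
  by rewrite -scalemxAr wE -vE scale_scalar_mx mulVf.
pose g e : 'M[R]_m := 1%:M + (e - 1) *: (c *m w).
have wg e : w *m g e = e *: w.
  by rewrite mulmxDr mulmx1 -scalemxAr mulmxA wc mul1mx scalerBl scale1r subrKC.
pose f e : 'M[R]_(n, m) := A *m g e + delta_mx i 0 *m w.
have EA : delta_mx i j *m A = delta_mx i 0 *m w.
  by rewrite /w rowE mulmxA mul_delta_mx.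
have fE e : e != 0 -> f e = (1%:M + e^-1 *: delta_mx i j) *m (A *m g e).
  move=> e0; rewrite mulmxDl mul1mx -scalemxAl mulmxA EA -mulmxA wg -scalemxAr.
  by rewrite scalerA mulVf// scale1r.
have gu e : e != 0 -> g e \in unitmx.
  move=> e0; have /mulmx1_unit[] : g e *m g e^-1 = 1%:M; last by [].
  rewrite /g mulmxDl mul1mx -scalemxAl -mulmxA wg -scalemxAr scalerA.
  rewrite -addrA -scalerDl mulrBl mulfV// mul1r.
  suff -> : e^-1 - 1 + (1 - e^-1) = 0 by rewrite scale0r addr0.
  by rewrite addrA subrK subrr.
have fD e : 0 < e -> D (f e).
  move=> e0; have en0 := lt0r_neq0 e0.
  have ei0 : 0 <= e^-1 by rewrite invr_ge0 ltW.
  have rf : \rank (f e) == m.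
    rewrite fE// mulmxA mxrankMfree ?row_free_unit ?gu//.
    rewrite -mxrank_tr trmx_mul mxrankMfree ?mxrank_tr ?frame_rankE//.
    by rewrite row_free_unit unitmx_tr elementary_unit.
  suff /ZD : Z (grass_class (MkFrame rf)) by [].
  rewrite (_ : grass_class _ = grass_act (elementary ei0 i j) V); first exact: ZV.
  apply: val_inj; rewrite /= VA (grass_act_class (elementary ei0 i j)) /=.
  apply/esym/colspan_eqP; last by exists (g e); rewrite ?gu// fE// mulmxA.
    rewrite -mxrank_tr trmx_mul mxrankMfree ?mxrank_tr ?frame_rank//.
    by rewrite row_free_unit unitmx_tr elementary_unit.
  exact/eqP.
have fc : continuous f.
  move=> e; apply: cts_mxP => a b.
  have fab x : f x a b = (A a b + (delta_mx i 0 *m w) a b) + (x - 1) * (A *m c *m w) a b.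
    by rewrite /f /g mulmxDr mulmx1 -scalemxAr mulmxA !mxE addrAC.
  under eq_fun do rewrite fab.
  rewrite fab; apply: cvgD; first exact: cvg_cst.
  apply: cvgM; last exact: cvg_cst.
  by apply: cvgB; [exact: cvg_id|exact: cvg_cst].
(* The limit is one-sided, since the parameter 1/e of the elementary matrix has to be
   nonnegative. *)
have f0D : D (f 0).
  apply: (@closed_cvg _ _ (0 : R)^'+ _ f D cD) => /=.
    by near=> e; apply: fD; near: e; exact: nbhs_right_gt.
  by apply: cvg_at_right_filter; exact: fc.
have f0k k : w *m k = 0 -> f 0 *m k = A *m k.
  move=> wk; rewrite /f /g mulmxDl mulmxDr mulmx1 sub0r scaleN1r.
  rewrite -[_ *m w *m k]mulmxA wk mulmx0 addr0 mulmxN mulmxBl -!mulmxA wk.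
  by rewrite !mulmx0 subr0.
have f0c : f 0 *m c = delta_mx i 0.
  rewrite /f mulmxDl -[_ *m w *m c]mulmxA wc mulmx1 -mulmxA /g mulmxDl mul1mx.
  by rewrite sub0r scaleN1r mulNmx -mulmxA wc mulmx1 subrr mulmx0 add0r.
(* [f 0] agrees with [A] on the kernel of [w] and sends [c] to e_i. Splitting a kernel vector of
   [f 0] along [c], a nonzero component on [c] would put e_i in [V]; so the vector lies in the
   kernel of [A], which is zero. *)
have f0r : \rank (f 0) == m.
  rewrite -mxrank_tr; apply: inj_row_free => k kf0.
  have {kf0} f0k0 : f 0 *m k^T = 0.
    by apply: trmx_inj; rewrite trmx_mul trmxK trmx0.
  have wk : w *m k^T = 0.
    have dk : k^T = (k^T - c *m (w *m k^T)) + c *m (w *m k^T) by rewrite subrK.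
    move: f0k0; rewrite {1}dk mulmxDr f0k; last first.
      by rewrite mulmxBr [w *m (c *m _)]mulmxA wc mul1mx subrr.
    rewrite [f 0 *m (c *m _)]mulmxA f0c wE => /eqP.
    rewrite addr_eq0 [delta_mx i 0 *m _]mul_mx_scalar => /eqP Ad.
    have [->|a0] := eqVneq ((A *m k^T) j 0) 0; first exact: raddf0.
    case/negP: iV; rewrite -[delta_mx i 0]scale1r -(mulVf a0) -scalerA memvZ//.
    by rewrite -rpredN -Ad VA; apply/colspanP; eexists.
  move: f0k0; rewrite f0k// => Ak0; apply: trmx_inj; rewrite trmx0.
  have Af : row_free A^T by rewrite /row_free mxrank_tr frame_rank.
  by apply: trmx_inj; apply: (row_free_inj Af); rewrite -trmx_mul Ak0 !trmx0 mul0mx.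
exists (grass_class (MkFrame f0r)); first exact/ZD.
split=> [|u]; first by apply/colspanP; exists c; rewrite f0c.
rewrite VA => /colspanP[k ->] uj0; apply/colspanP; exists k.
by rewrite f0k// wE uj0 raddf0.
Unshelve. all: by end_near.
Qed.

(** * Closed orbits of an incidence group are fixed points *)

Hypothesis po_anti : antisymmetric po.
Hypothesis po_trans : transitive po.

(** The span F_i of the e_k with k below i, as the kernel of the projection onto the other
    coordinates. *)
Definition ideal_space (i : 'I_n) : {vspace 'cV[R]_n} :=
  lker (linfun (mulmx (diag_mx (\row_k (~~ po k i)%:R)) : 'cV[R]_n -> 'cV[R]_n)).

Lemma ideal_spaceP (i : 'I_n) (v : 'cV[R]_n) :
  v \in ideal_space i <-> forall k, ~~ po k i -> v k 0 = 0.
Proof.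
rewrite memv_ker lfunE /= mul_diag_mx; split=> [/eqP/colP vi k ki|vi].
  by have := vi k; rewrite !mxE ki mul1r.
apply/eqP/colP => k; rewrite !mxE; case: (boolP (po k i)) => [_|/vi ->].
  by rewrite mul0r.
by rewrite mulr0.
Qed.

Lemma ideal_space_stable (i : 'I_n) (h : GL R n) (v : 'cV[R]_n) :
  incidence_group h -> v \in ideal_space i -> GLmx h *m v \in ideal_space i.
Proof.
move=> hH /ideal_spaceP vi; apply/ideal_spaceP => k ki; rewrite mxE big1// => l _.
have [kl|/hH ->] := boolP (po k l); last by rewrite mul0r.
by rewrite vi ?mulr0//; apply: contra ki; exact: po_trans.
Qed.

Lemma closed_orbit_mem m (W : grassmann R n m) (i j : 'I_n) (v : 'cV[R]_n) :
  closed [set grass_act h W | h in incidence_group] ->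
  po i j -> v \in grass_vs W -> v j 0 != 0 ->
  (forall u, u \in grass_vs W -> u \in ideal_space i -> u j 0 = 0) ->
  delta_mx i 0 \in grass_vs W.
Proof.
move=> cZ ij vW vj0 Wij; apply: contraT => iW.
have ZW s (s0 : 0 <= s) :
    [set grass_act h W | h in incidence_group] (grass_act (elementary s0 i j) W).
  by exists (elementary s0 i j) => //; exact: elementary_incidence.
have [_ [h hH <-] [iW' WW']] := elementary_limit cZ ZW vW vj0 iW.
(* The limit lies in the orbit, and F_i is stable, so the dimensions agree; the inclusion holds
   because the j-th coordinate vanishes on the left-hand side. *)
have /eqP eW : (grass_vs W :&: ideal_space i ==
    grass_vs (grass_act h W) :&: ideal_space i)%VS.
  rewrite eqEdim grass_act_dim_cap ?leqnn ?andbT; last first.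
    by move=> u; exact: ideal_space_stable.
  apply/subvP => u /memv_capP[uW ui]; apply/memv_capP; split=> //.
  by apply: WW' => //; exact: Wij.
suff : delta_mx i 0 \in (grass_vs W :&: ideal_space i)%VS.
  by move=> /memv_capP[]; rewrite (negbTE iW).
rewrite eW; apply/memv_capP; split=> //; apply/ideal_spaceP => k ki.
by rewrite mxE; case: eqVneq ki => // ->; rewrite po_refl.
Qed.

Lemma closed_orbit_fixed m (W : grassmann R n m) :
  closed [set grass_act h W | h in incidence_group] ->
  fixed_points incidence_group W.
Proof.
move=> cZ; apply/(incidence_fixedP W).
have lt_mem i j v : po i j -> i != j -> v \in grass_vs W -> v j 0 != 0 ->
    delta_mx i 0 \in grass_vs W.
  move=> ij nij vW vj0; apply: (closed_orbit_mem cZ ij vW vj0) => u _ /ideal_spaceP; apply.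
  by apply: contra nij => ji; apply/eqP/po_anti; rewrite ij ji.
move=> i j v ij vW vj0; have [eij|nij] := eqVneq i j; last exact: lt_mem ij nij vW vj0.
subst j; apply: contraT => iW.
have := closed_orbit_mem cZ ij vW vj0; rewrite (negbTE iW); apply => u uW ui.
(* If u_i <> 0, the case of distinct indices puts in [W] every e_k with k strictly below i. As [u]
   is supported below i, subtracting these terms leaves u_i e_i in [W]. *)
apply: contraNeq iW => ui0.
have uE : u i 0 *: delta_mx i 0 = u - \sum_(k | k != i) u k 0 *: delta_mx k 0.
  apply/colP => l; rewrite !mxE summxE.
  have [->|li] := eqVneq l i.
    rewrite big1 ?subr0 ?mulr1// => k ki.
    by rewrite !mxE eq_sym (negbTE ki) mulr0.
  rewrite (bigD1 l)//= big1 ?addr0 => [|k /andP[_ kl]].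
    by rewrite !mxE !eqxx mulr1 subrr mulr0.
  by rewrite !mxE eq_sym (negbTE kl) mulr0.
suff : u i 0 *: delta_mx i 0 \in grass_vs W by rewrite rpredZeq (negbTE ui0).
rewrite uE rpredB// rpred_sum// => k ki.
have [->|uk0] := eqVneq (u k 0) 0; first by rewrite scale0r mem0v.
apply: memvZ; apply: (lt_mem k i u) => //.
by apply: contraNT uk0 => nki; apply/eqP; move/ideal_spaceP: ui; exact.
Qed.

End IncidenceGroup.

(** * The group B' as an incidence group *)

Section LeviBorel.
Import Order.TTheory GRing.Theory Num.Theory.
Local Open Scope ring_scope.
Context {R : realType} {n1 n2 : nat}.

Definition block_le : rel 'I_(n1 + n2) :=
  fun i j => (i <= j)%N && ((i < n1)%N == (j < n1)%N).

Lemma block_le_refl : reflexive block_le.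
Proof. by move=> i; rewrite /block_le leqnn eqxx. Qed.

Lemma block_le_anti : antisymmetric block_le.
Proof.
move=> i j /andP[/andP[ij _] /andP[ji _]]; apply: val_inj.
by apply/eqP; rewrite eqn_leq ij ji.
Qed.

Lemma block_le_trans : transitive block_le.
Proof.
move=> j i k /andP[ij /eqP eij] /andP[jk /eqP ejk].
by rewrite /block_le (leq_trans ij jk) eij ejk eqxx.
Qed.

Lemma levi_borelE : levi_borel R n1 n2 = incidence_group block_le.
Proof.
apply/seteqP; split=> g.
  move=> [[a [d [_ _ gE]]] gU] i j.
  rewrite negb_and -ltnNge => /orP[|]; first exact: gU.
  by rewrite gE !mxE; case: splitP => k _; rewrite mxE; case: splitP => l _;
    rewrite ?mxE.
move=> gH; split; last first.
  by move=> i j ji; apply: gH; rewrite /block_le leqNgt ji.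
have gE : GLmx g = block_mx (ulsubmx (GLmx g)) 0 0 (drsubmx (GLmx g)).
  rewrite -[LHS]submxK; congr block_mx; apply/matrixP => i j; rewrite !mxE gH//.
    by rewrite /block_le /= ltn_ord ltnNge leq_addr andbF.
  by rewrite /block_le /= ltn_ord ltnNge leq_addr andbF.
(* The determinant is the product of those of the diagonal blocks, so both are invertible. *)
exists (ulsubmx (GLmx g)), (drsubmx (GLmx g)).
by have := GLmx_unit g; rewrite {1}gE !unitmxE det_ublock unitrM => /andP[-> ->].
Qed.

Lemma point_mx_pos_subproof (a r : nat) (j : 'I_(a + r)) :
  (a <= n1)%N -> (r <= n2)%N -> ((if (j < r)%N then n1 + j else j - r) < n1 + n2)%N.
Proof. by case: ifP; move: (ltn_ord j); lia. Qed.

Definition block_initial (a r : nat) : pred 'I_(n1 + n2) :=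
  fun k => (k < a)%N || (n1 <= k < n1 + r)%N.

(** * Column spans of the explicit matrices *)

Section PointMatrix.
Context {a r : nat}.
Hypotheses (an1 : (a <= n1)%N) (rn2 : (r <= n2)%N).

(** The row of the only 1 in column [j]. Writing the width as [a + r] avoids the truncated
    subtraction in a = m - r. *)
Definition point_mx_pos (j : 'I_(a + r)) : 'I_(n1 + n2) :=
  Ordinal (point_mx_pos_subproof j an1 rn2).

Lemma point_mx_pos_inj : injective point_mx_pos.
Proof.
move=> j l /(congr1 val) /= e; apply: val_inj => /=; move: e.
by case: ifP; case: ifP; move: (ltn_ord j) (ltn_ord l); lia.
Qed.

Lemma point_mx_pos_codom (k : 'I_(n1 + n2)) :
  reflect (exists j, k = point_mx_pos j) (block_initial a r k).
Proof.
apply: (iffP orP) => [[ka|/andP[nk kr]]|[j ->]] /=.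
- have lt : (k + r < a + r)%N by rewrite ltn_add2r.
  by exists (Ordinal lt); apply: val_inj; rewrite /= ltnNge leq_addl addnK.
- have lt : (k - n1 < a + r)%N by lia.
  by exists (Ordinal lt); apply: val_inj => /=; case: ifP; lia.
- by case: ifP; move: (ltn_ord j); lia.
Qed.

Lemma point_mxE (k : 'I_(n1 + n2)) (j : 'I_(a + r)) :
  point_mx R n1 n2 (a + r) r k j = (k == point_mx_pos j)%:R.
Proof.
rewrite mxE -val_eqE /=; case: splitP => i ->; rewrite mxE; congr (nat_of_bool _)%:R.
  by case: ifP; move: (ltn_ord i) (ltn_ord j); lia.
by case: ifP; move: (ltn_ord i) (ltn_ord j); lia.
Qed.

Lemma mul_point_mx_pos (c : 'cV[R]_(a + r)) (j : 'I_(a + r)) :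
  (point_mx R n1 n2 (a + r) r *m c) (point_mx_pos j) 0 = c j 0.
Proof.
rewrite mxE (bigD1 j)//= big1 ?addr0; first by rewrite point_mxE eqxx mul1r.
move=> l lj; rewrite point_mxE (inj_eq point_mx_pos_inj) eq_sym.
by rewrite (negbTE lj) mul0r.
Qed.

Lemma rank_point_mx : \rank (point_mx R n1 n2 (a + r) r) = (a + r)%N.
Proof.
rewrite -mxrank_tr; apply/eqP; apply: inj_row_free => v vP.
apply/rowP => j; have : (point_mx R n1 n2 (a + r) r *m v^T) (point_mx_pos j) 0 = 0.
  by rewrite -[point_mx _ _ _ _ _]trmxK -trmx_mul vP !mxE.
by rewrite mul_point_mx_pos !mxE.
Qed.

Lemma mem_point_mx (v : 'cV[R]_(n1 + n2)) :
  v \in colspan (point_mx R n1 n2 (a + r) r) <->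
  forall k, ~~ block_initial a r k -> v k 0 = 0.
Proof.
split=> [/colspanP[c ->] k ka|va].
  rewrite mxE big1// => j _; rewrite point_mxE; case: eqVneq => [kj|_].
    by case/negP: ka; apply/point_mx_pos_codom; exists j.
  by rewrite mul0r.
apply/colspanP; exists (\col_j v (point_mx_pos j) 0); apply/colP => k.
have [/point_mx_pos_codom[j ->]|ka] := boolP (block_initial a r k).
  by rewrite mul_point_mx_pos mxE.
rewrite va// mxE big1// => j _; rewrite point_mxE; case: eqVneq => [kj|_].
  by case/negP: ka; apply/point_mx_pos_codom; exists j.
by rewrite mul0r.
Qed.

End PointMatrix.

(** * Classification of the fixed points *)

Lemma ord_downset n (S : pred 'I_n) :
  (forall i j : 'I_n, (i <= j)%N -> S j -> S i) ->
  exists2 a, (a <= n)%N & forall i, S i = (i < a)%N.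
Proof.
(* The bound [a] is the least k that is not the index of an element of [S]; k = n always qualifies,
   so [a] exists and is at most n. *)
move=> Sd; pose P k := ~~ [exists i : 'I_n, (i == k :> nat) && S i].
have exP : exists k, P k.
  exists n; apply/existsPn => i; rewrite negb_and.
  by move: (ltn_ord i); rewrite ltn_neqAle => /andP[->].
case: (ex_minnP exP) => a Pa amin; exists a.
  apply: amin; apply/existsPn => i; rewrite negb_and.
  by move: (ltn_ord i); rewrite ltn_neqAle => /andP[->].
move=> i; apply/idP/idP => [Si|ia].
  rewrite ltnNge; apply: contra Pa => ai; apply/existsP.
  exists (Ordinal (leq_ltn_trans ai (ltn_ord i))); rewrite /= eqxx /=.
  by apply: Sd Si.
have : ~~ P i by apply: contraL ia => /amin; rewrite -leqNgt.
by rewrite negbK => /existsP[k /andP[/eqP/val_inj ->]].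
Qed.

Lemma levi_borel_fixedP m (V : grassmann R (n1 + n2) m) :
  fixed_points (levi_borel R n1 n2) V <->
  exists2 r, (maxn 0 (m - n1) <= r <= minn m n2)%N &
    grass_vs V = colspan (point_mx R n1 n2 m r).
Proof.
rewrite levi_borelE (incidence_fixedP block_le_refl V); split.
  move=> VS.
  have VS1 i j : block_le i j -> delta_mx j 0 \in grass_vs V ->
      delta_mx i 0 \in grass_vs V.
    by move=> ij jV; apply: VS ij jV _; rewrite mxE !eqxx oner_neq0.
  have [|a an1 aV] := @ord_downset n1 (fun i => delta_mx (lshift n2 i) 0 \in grass_vs V).
    by move=> i j ij; apply: VS1; rewrite /block_le /= ij !ltn_ord.
  have [|r rn2 rV] := @ord_downset n2 (fun i => delta_mx (rshift n1 i) 0 \in grass_vs V).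
    by move=> i j ij; apply: VS1; rewrite /block_le /= leq_add2l ij !ltnNge !leq_addr.
  have kV k : (delta_mx k 0 \in grass_vs V) = block_initial a r k.
    rewrite /block_initial -[k]splitK; case: (fintype.split k) => i /=.
      by rewrite aV [(n1 <= i)%N]leqNgt ltn_ord orbF.
    by rewrite rV leq_addr ltn_add2l /= orbC; case: ltnP => //= ?; lia.
  (* Reflexivity of the order gives e_k in [V] as soon as some vector of [V] has v_k <> 0, so [V] is
     spanned by the basis vectors it contains. *)
  have VE : grass_vs V = colspan (point_mx R n1 n2 (a + r) r).
    apply/vspaceP => v; apply/idP/idP => [vV|/(mem_point_mx an1 rn2) va].
      apply/(mem_point_mx an1 rn2) => k; rewrite -kV; apply: contraNeq.
      exact/VS/vV/block_le_refl.
    rewrite (matrix_sum_delta v); apply: memv_suml => k _.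
    rewrite big_ord1; have [ka|/va ->] := boolP (block_initial a r k).
      by apply: memvZ; rewrite kV.
    by rewrite scale0r mem0v.
  (* Comparing dimensions gives a = m - r, and the bounds on [a] and [r] become the range of [r]. *)
  have am : (a + r)%N = m.
    by rewrite -(grass_dim V) VE colspan_dim// rank_point_mx.
  by exists r; [lia|rewrite VE -am].
case=> r rb VE i j v ij.
have an1 : (m - r <= n1)%N by lia.
have rn2 : (r <= n2)%N by lia.
have am : m = (m - r + r)%N by lia.
rewrite VE; move: rn2 an1 => rn2; move: (m - r)%N am => a am an1.
subst m => /(mem_point_mx an1 rn2) va vj0.
have ja : block_initial a r j by apply: contraNT vj0 => /va ->.
apply/(mem_point_mx an1 rn2) => k ka; rewrite mxE; case: eqVneq ka => // ->.
by move: ij ja; rewrite /block_le /block_initial; lia.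
Qed.

End LeviBorel.

Theorem corollaryC (R : realType) (n1 n2 m1 m2 : nat)
    (hn1 : 0 < n1) (hn2 : 0 < n2) (hm1 : 0 < m1) (hm2 : 0 < m2)
    (hn : m1 + m2 = n1 + n2) :
  [set Z : set (grassmann R (n1 + n2) m1) |
     is_orbit (levi_borel R n1 n2) Z /\ closed Z]
  = [set [set V] | V in fixed_points (levi_borel R n1 n2)]
  /\
  [set grass_vs V |
     V in fixed_points (levi_borel R n1 n2) : set (grassmann R (n1 + n2) m1)]
  = [set colspan (point_mx R n1 n2 m1 r) |
     r in [set r : nat | maxn 0 (m1 - n1) <= r <= minn m1 n2]].
Proof.
have orbit_fixed (V : grassmann R (n1 + n2) m1) :
    fixed_points (levi_borel R n1 n2) V ->
    [set V] = [set grass_act h V | h in levi_borel R n1 n2].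
  (* Any element of the group fixes [V], so one element suffices to show that [V] belongs to its own
     orbit. *)
  move=> Vf; have [h hB] := @incidence_group1 R _ _ (@block_le_refl n1 n2).
  rewrite -levi_borelE in hB.
  apply/seteqP; split=> [_ ->|_ [g gB <-]]; last exact: Vf.
  by exists h => //; exact: Vf.
split; apply/seteqP; split.
- move=> _ [[V ->] cV]; have Vf : fixed_points (levi_borel R n1 n2) V.
    move: cV; rewrite levi_borelE; apply: closed_orbit_fixed.
    + exact: block_le_refl.
    + exact: block_le_anti.
    + exact: block_le_trans.
  by exists V => //; exact: orbit_fixed.
- move=> _ [V Vf <-]; split; last exact: grass_closed1.
  by exists V; exact: orbit_fixed.
- by move=> _ [V /levi_borel_fixedP[r rb ->] <-]; exists r.
move=> _ [r rb <-].
have dimP : \dim (colspan (point_mx R n1 n2 m1 r)) == m1.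
  have -> : m1 = m1 - r + r by move: rb => /=; lia.
  by rewrite colspan_dim// rank_point_mx//; move: rb => /=; lia.
by exists (MkGrassmann dimP) => //; apply/levi_borel_fixedP; exists r.
Qed.
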